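(* Let $\{C,D\}$ be a Kaprekar 2-cycle. \begin{enumerate} \item If $\{C,D\}\neq\{53955,59994\}$, then the digit sum of $C$ equals the digit sum of $D$. \item Both $C$ and $D$ contain the digit $9$. \end{enumerate}
   Context: All integers are written in base 10. Fix a number of digits $n$; integers are written with exactly $n$ decimal digits, padded with leading zeros if necessary. For such an integer $N$, $\overline{N}$ and $\underline{N}$ denote the numbers obtained by writing the $n$ digits of $N$ in descending and ascending order respectively, and $k(N)=\overline{N}-\underline{N}$, again regarded as an $n$-digit number (padded with leading zeros if necessary). A Kaprekar 2-cycle is a pair $\{C,D\}$ of distinct $n$-digit integers (for some $n$) with $k(C)=D$ and $k(D)=C$. *)

(* Defs.v *)
From mathcomp Require Import all_boot.

Set Implicit Arguments.
Unset Strict Implicit.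
Unset Printing Implicit Defensive.

(* The n decimal digits of N, most significant first, padded with leading
   zeros; this represents N faithfully only when N < 10 ^ n. *)
Definition digits (n N : nat) : seq nat :=
  mkseq (fun i => N %/ 10 ^ (n - i.+1) %% 10) n.

Definition of_digits (s : seq nat) : nat :=
  foldl (fun a d => 10 * a + d) 0 s.

Definition descending (n N : nat) : nat := of_digits (sort geq (digits n N)).

Definition ascending (n N : nat) : nat := of_digits (sort leq (digits n N)).

(* The subtraction on nat is never truncated here: the descending arrangement
   of the digits is the largest one. *)
Definition kaprekar (n N : nat) : nat := descending n N - ascending n N.

Definition digit_sum (n N : nat) : nat := \sum_(d <- digits n N) d.

Definition kaprekar_2cycle (n C D : nat) : Prop :=
  [/\ C < 10 ^ n, D < 10 ^ n, C <> D, kaprekar n C = D & kaprekar n D = C].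

(* Main.v *)
Require Import Defs.
From mathcomp Require Import all_boot finmap zify.

Set Implicit Arguments.
Unset Strict Implicit.
Unset Printing Implicit Defensive.

(* Let d be the sequence of the n digits of N in descending order and call the
   differences d_i - d_(n-1-i) of mirror digits the gaps of N. Subtracting with
   borrows, the digits of k(N) are determined by the r positive gaps: they are
   n - 2r nines together with x and 9 - x for every positive gap x, up to two
   corrections by 1. Hence the digit sum of k(N) is 9 (n - r). In turn, with X j
   the number of gaps that are at least j, and G t the number of digits that are at
   least t, both referring to the same number,
     min (G (t + j)) (n - G (t + 1)) <= X j <= max (G (t + j)) (n - G t)
   for all t, so a 2-cycle yields a system of inequalities between the counting
   functions X and Y of the gaps of C and D. Among n - 2 Y(1) nines and the pairs
   y, 9 - y, splitting the digits between 4 and 5 gives X 1 >= Y 1 - 1, and equality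
   X 1 = Y 1 - 1 is possible only for {53955, 59994}. So the ranks agree. If D has
   no 9, then n = 2r, the bounds become exact, and the gaps y of D are essentially
   the |2x - 9|, which are odd; following the few even gaps created by the two
   corrections forces X = Y, that is C = D. *)

(** * Digit sequences and the numbers they denote *)

Lemma of_digits_rcons s d : of_digits (rcons s d) = 10 * of_digits s + d.
Proof. by rewrite /of_digits -cats1 foldl_cat. Qed.

Lemma of_digits_cat s1 s2 :
  of_digits (s1 ++ s2) = of_digits s1 * 10 ^ size s2 + of_digits s2.
Proof.
elim/last_ind: s2 => [|s2 d IHs]; first by rewrite cats0 muln1 addn0.
by rewrite -rcons_cat !of_digits_rcons size_rcons expnS IHs; lia.
Qed.

Lemma of_digits_nseq0 k s : of_digits (nseq k 0 ++ s) = of_digits s.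
Proof. by elim: k. Qed.

Lemma of_digits_zeros k s : of_digits (s ++ nseq k 0) = of_digits s * 10 ^ k.
Proof.
by rewrite of_digits_cat size_nseq -[nseq k 0]cats0 of_digits_nseq0 addn0.
Qed.

Lemma of_digits_mkseq f n :
  of_digits (mkseq f n) = \sum_(i < n) f i * 10 ^ (n - i.+1).
Proof.
elim: n => [|n IHn]; first by rewrite big_ord0.
rewrite mkseqS of_digits_rcons IHn big_ord_recr /= subnn muln1 big_distrr /=.
by congr (_ + _); apply: eq_bigr => i _; rewrite subSn // expnS mulnCA.
Qed.

(** The two digits at each place add up to 9, so the two numbers add up to a string of nines. *)
Lemma of_digits_compl s : all (geq 9) s ->
  of_digits [seq 9 - d | d <- s] + of_digits s + 1 = 10 ^ size s.
Proof.
elim/last_ind: s => // s d IHs; rewrite all_rcons /= => /andP[d9 /IHs E].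
by rewrite map_rcons !of_digits_rcons size_rcons expnS -E; lia.
Qed.

Lemma size_digits n N : size (digits n N) = n.
Proof. exact: size_mkseq. Qed.

Lemma digits_le9 n N : all (geq 9) (digits n N).
Proof. by apply/allP => _ /mapP[i _ ->] /=; rewrite -ltnS ltn_mod. Qed.

Lemma digitsS n N : digits n.+1 N = rcons (digits n (N %/ 10)) (N %% 10).
Proof.
rewrite /digits mkseqS subnn divn1; congr rcons; apply/eq_in_map => i.
by rewrite mem_iota /= => lt_in; rewrite subSn // expnS divnMA.
Qed.

Lemma of_digitsK s : all (geq 9) s -> digits (size s) (of_digits s) = s.
Proof.
elim/last_ind: s => // s d IHs; rewrite all_rcons /= => /andP[d9 s9].
rewrite size_rcons digitsS of_digits_rcons mulnC divnMDl // modnMDl.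
by rewrite divn_small // modn_small // addn0 IHs.
Qed.

(** * Sorted digits and their gaps *)

(** Large entries form a prefix of a descending list. Positivity of [t] matters because [nth]
    returns 0 past the end. *)
Lemma geq_sortedP s : sorted geq s -> forall t i, 0 < t ->
  (t <= nth 0 s i) = (i < count (leq t) s).
Proof.
elim: s => [_ t i t0|d s IHs /= ds t i t0]; first by rewrite nth_nil /=; lia.
have {IHs} IHs := IHs (path_sorted ds) t.
case: i => [|i] /=.
  case: (leqP t d) => //= lt_dt; rewrite add0n -(IHs 0 t0).
  by case: s ds {IHs} => [|e s /= /andP[? _]]; rewrite /= -?ltnNge; lia.
rewrite IHs //; case: (leqP t d) => //= lt_dt; rewrite add0n.
have -> : count (leq t) s = 0.
  apply/eqP; rewrite -leqn0 leqNgt -has_count; apply/hasPn => e.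
  by move/(allP (order_path_min (rev_trans leq_trans) ds)) => /=; lia.
by [].
Qed.

Definition sdigits n N := sort geq (digits n N).
(* Truncated subtraction makes the second half of this sequence zero. *)
Definition gaps n N :=
  mkseq (fun i => nth 0 (sdigits n N) i - nth 0 (sdigits n N) (n - i.+1)) n.
Definition ngaps n N j := count (leq j) (gaps n N).
Definition ndigits n N t := count (leq t) (digits n N).

Lemma sdigits_sorted n N : sorted geq (sdigits n N).
Proof. by apply: sort_sorted => a b; exact: leq_total. Qed.

Lemma size_sdigits n N : size (sdigits n N) = n.
Proof. by rewrite size_sort size_digits. Qed.

Lemma count_sdigits n N a : count a (sdigits n N) = count a (digits n N).
Proof. by apply/permP; rewrite perm_sort. Qed.

Lemma ascendingE n N : sort leq (digits n N) = rev (sdigits n N).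
Proof.
apply: (sorted_eq leq_trans anti_leq); first exact: sort_sorted leq_total _.
  by rewrite rev_sorted; exact: sdigits_sorted.
by rewrite perm_sort perm_sym perm_rev perm_sort.
Qed.

Lemma sdigitsE n N t i : 0 < t -> (t <= nth 0 (sdigits n N) i) = (i < ndigits n N t).
Proof. by move=> t0; rewrite geq_sortedP ?sdigits_sorted // count_sdigits. Qed.

Lemma sdigits_antitone n N i j : i <= j ->
  nth 0 (sdigits n N) j <= nth 0 (sdigits n N) i.
Proof.
move=> ij; case: (posnP (nth 0 (sdigits n N) j)) => [-> //|p0].
by rewrite sdigitsE //; apply: leq_ltn_trans ij _; rewrite -sdigitsE.
Qed.

Lemma size_gaps n N : size (gaps n N) = n.
Proof. exact: size_mkseq. Qed.

Lemma gaps_nth n N i : i < n ->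
  nth 0 (gaps n N) i = nth 0 (sdigits n N) i - nth 0 (sdigits n N) (n - i.+1).
Proof. by move=> ltin; rewrite nth_mkseq. Qed.

Lemma gaps_sorted n N : sorted geq (gaps n N).
Proof.
apply/(sortedP 0) => i; rewrite size_mkseq => lti /=.
rewrite !gaps_nth ?(ltnW lti) // -/(geq _ _).
by apply: leq_sub; apply: sdigits_antitone; lia.
Qed.

Lemma gapsE n N j i : 0 < j -> (j <= nth 0 (gaps n N) i) = (i < ngaps n N j).
Proof. by move=> j0; rewrite geq_sortedP ?gaps_sorted. Qed.

Lemma gaps_le9 n N : all (geq 9) (gaps n N).
Proof.
apply/(all_nthP 0) => i; rewrite size_mkseq => ltin; rewrite gaps_nth //=.
have /(all_nthP 0)/(_ i) : all (geq 9) (sdigits n N) by rewrite all_sort digits_le9.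
by rewrite size_sdigits => /(_ ltin) /=; lia.
Qed.

(** Of a gap and its mirror gap at least one is truncated to zero, so their difference is the signed
    difference of the two digits. *)
Lemma kaprekarE n N : kaprekar n N = of_digits (gaps n N) - of_digits (rev (gaps n N)).
Proof.
rewrite /kaprekar /descending /ascending ascendingE -/(sdigits n N).
rewrite /gaps; set d := nth 0 _.
have -> : sdigits n N = mkseq d n.
  apply: (@eq_from_nth _ 0); rewrite size_sdigits ?size_mkseq // => i lti.
  by rewrite nth_mkseq.
have rev_mkseq (f : nat -> nat) : rev (mkseq f n) = mkseq (fun i => f (n - i.+1)) n.
  apply: (@eq_from_nth _ 0); rewrite size_rev !size_mkseq // => i lti.
  by rewrite nth_rev !size_mkseq // !nth_mkseq //; lia.
rewrite !rev_mkseq !of_digits_mkseq.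
(* Both sides of the place-wise identity below are the maximum of d i and
   d (n - i.+1), thanks to truncated subtraction. *)
suff: \sum_(i < n) d i * 10 ^ (n - i.+1) +
      \sum_(i < n) (d (n - i.+1) - d (n - (n - i.+1).+1)) * 10 ^ (n - i.+1) =
      \sum_(i < n) d (n - i.+1) * 10 ^ (n - i.+1) +
      \sum_(i < n) (d i - d (n - i.+1)) * 10 ^ (n - i.+1) by lia.
rewrite -!big_split; apply: eq_bigr => i _ /=.
by rewrite -!mulnDl; congr (_ * _); rewrite subnSK // subKn 1?ltnW //; lia.
Qed.

Lemma gaps_decomp n N (r := ngaps n N 1) :
  gaps n N = take r (gaps n N) ++ nseq (n - r) 0.
Proof.
rewrite -{1}(cat_take_drop r (gaps n N)); congr (_ ++ _).
apply: (@eq_from_nth _ 0); rewrite size_drop size_mkseq ?size_nseq // => i lti.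
rewrite nth_drop nth_nseq lti; apply/eqP; rewrite -leqn0 leqNgt gapsE //; lia.
Qed.

Lemma ngaps_le n N j : ngaps n N j <= n.
Proof. by have := count_size (leq j) (gaps n N); rewrite size_mkseq. Qed.

Lemma ngaps1_double_le n N : (ngaps n N 1).*2 <= n.
Proof.
case E: (ngaps n N 1) => [|r] //.
have rn: r < n by rewrite -E ngaps_le.
have : 0 < nth 0 (gaps n N) r by rewrite gapsE // E.
rewrite gaps_nth // subn_gt0; case: (leqP r.+1 (n - r.+1)) => [|h]; first by lia.
have := @sdigits_antitone n N (n - r.+1) r h; lia.
Qed.

Lemma ndigits_le n N t : ndigits n N t <= n.
Proof. by rewrite -[leqRHS](size_digits n N) count_size. Qed.

(** Were both alternatives false, the digit at index [ngaps n N j] would be at least [t + j] and its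
    mirror digit at most [t], giving one more gap that is at least [j]. *)
Lemma ngaps_lower n N t j : 0 < j ->
  (ndigits n N (t + j) <= ngaps n N j) ||
  (n <= ngaps n N j + ndigits n N t.+1).
Proof.
move=> j0; apply/orP; case: leqP => [|lt1]; [by left | right].
set i := ngaps n N j in lt1 *; rewrite leqNgt; apply/negP => lt2.
have i_n : i < n by apply: leq_trans lt1 (ndigits_le _ _ _).
suff : i < ngaps n N j by rewrite ltnn.
rewrite -gapsE // gaps_nth //.
have d1 : t + j <= nth 0 (sdigits n N) i by rewrite sdigitsE //; lia.
have d2 : nth 0 (sdigits n N) (n - i.+1) <= t by rewrite leqNgt sdigitsE //; lia.
lia.
Qed.

Lemma ngaps_upper n N t j : 0 < j ->
  (ngaps n N j <= ndigits n N (t + j)) ||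
  (ngaps n N j + ndigits n N t <= n).
Proof.
move=> j0; apply/orP; case: (leqP (ngaps n N j)) => [|lt1]; [by left | right].
rewrite leqNgt; apply/negP => lt2.
(* At this index the digit is below [t + j] and, for positive [t], its mirror digit is at least [t];
   so the gap is below [j]. *)
set i := maxn (ndigits n N (t + j)) (n - ndigits n N t).
have ix : i < ngaps n N j by rewrite /i; lia.
have iN : i < n by apply: leq_trans ix (ngaps_le _ _ _).
have := ix; rewrite -gapsE // gaps_nth //.
have d1 : nth 0 (sdigits n N) i < t + j by rewrite ltnNge sdigitsE //; lia.
case: (posnP t) => [t0|t0]; first by lia.
have d2 : t <= nth 0 (sdigits n N) (n - i.+1) by rewrite sdigitsE //; lia.
lia.
Qed.

(** * Subtraction with borrows *)

(** Borrowing 1 from the last digit [w] of [p] lends [10 ^ (k + size p)] to the lower places.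
    Subtracting [rev p] from this leaves a nines' complement plus 1, and the 1 turns the final 9 -
    [u] into 10 - [u]. *)
Lemma digits_borrow k p u w p' q' : p = rcons p' w -> p = u :: q' ->
  all (geq 9) p -> 0 < u -> 0 < w ->
  digits (k + (size p).*2) (of_digits p * 10 ^ (k + size p) - of_digits (rev p)) =
  rcons p' w.-1 ++ nseq k 9 ++ rcons [seq 9 - d | d <- rev q'] (10 - u).
Proof.
move=> Er Ep p9 u0 w0; set E := RHS.
have sz : size p = (size p').+1 by rewrite Er size_rcons.
have sq : size p = (size q').+1 by rewrite Ep.
have E9 : all (geq 9) E.
  have := p9; rewrite Er all_rcons /= => /andP[w9 p'9].
  have := p9; rewrite Ep /= => /andP[u9 q9].
  rewrite /E all_cat all_rcons all_cat all_rcons p'9 all_nseq orbT /=.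
  rewrite andbT; apply/and3P; split; [lia | lia |].
  by apply/allP => _ /mapP[e _ ->] /=; lia.
have szE : size E = k + (size p).*2.
  by rewrite /E !size_cat !size_rcons size_nseq size_map size_rev; lia.
rewrite -szE -[RHS]of_digitsK //; congr digits.
have -> : of_digits p = (of_digits (rcons p' w.-1)).+1.
  by rewrite Er !of_digits_rcons; lia.
rewrite /E of_digits_cat; set a := of_digits _; set T := nseq k 9 ++ _.
have -> : size T = k + size p.
  by rewrite /T size_cat size_rcons size_nseq size_map size_rev; lia.
have := @of_digits_compl (nseq k 0 ++ rev p).
rewrite all_cat all_nseq orbT all_rev p9 => /(_ erefl).
rewrite of_digits_nseq0 map_cat map_nseq size_cat size_nseq size_rev.
rewrite subn0.
have -> : of_digits T = (of_digits (nseq k 9 ++ [seq 9 - i | i <- rev p])).+1.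
  rewrite /T Ep rev_cons map_rcons -!rcons_cat !of_digits_rcons.
  by have := p9; rewrite Ep /= => /andP[]; lia.
by move=> <-; rewrite mulSn; lia.
Qed.

Lemma count_compl t s : 0 < t <= 9 -> all (geq 9) s ->
  count (leq t) [seq 9 - d | d <- s] + count (leq (10 - t)) s = size s.
Proof.
move=> t9; elim: s => //= d s IHs /andP[/= d9 /IHs E].
by rewrite addnACA E; lia.
Qed.

(** * From the gaps of a number to the digits and gaps of its image *)

(* u and w are the largest and the smallest positive gap when X = ngaps n N. *)
Definition gap_profile (X : nat -> nat) (u w : nat) :=
  [/\ 0 < w <= u, u <= 9, {homo X : i j / i <= j >-> j <= i},
   forall j, 0 < j -> (X j == X 1) = (j <= w)
   & forall j, 0 < j -> (0 < X j) = (j <= u)].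

(* X and Y are the functions ngaps of N and of D = kaprekar n N, and G t is the
   number of digits of D that are at least t. These digits are, up to order,
   n - 2 X(1) nines together with x and 9 - x for each positive gap x of N,
   except that one copy of w is lowered to w - 1 and one copy of 9 - u raised to
   10 - u. The variables s and b with their equations let instances at numerals
   be stated with numerals in normal form. *)
Definition gap_step (n : nat) (X Y : nat -> nat) (u w : nat) :=
  exists G : nat -> nat, [/\
   (forall t s, t + s = 10 -> 0 < t -> 0 < s ->
      G t + X s + X 1 + (t == w) = n + X t + (s == u)),
   (forall t j b, t + j = b -> 0 < j -> (G b <= Y j) || (n <= Y j + G t.+1)),
   (forall t j b, t + j = b -> 0 < j -> (Y j <= G b) || (Y j + G t <= n)),
   (forall t, 9 < t -> G t = 0) /\ G 0 = n & forall t, G t <= n].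

Lemma gaps_profile n N (X := ngaps n N) : 0 < X 1 ->
  gap_profile X (nth 0 (gaps n N) 0) (nth 0 (gaps n N) (X 1).-1).
Proof.
move=> r0; have Xh : {homo X : i j / i <= j >-> j <= i}.
  by move=> i j ij; apply: sub_count => d; exact: leq_trans.
split=> //.
- rewrite gapsE // prednK // leqnn /=.
  case: (posnP (nth 0 (gaps n N) (X 1).-1)) => [-> //|w0].
  by rewrite gapsE //; apply: leq_ltn_trans (leq0n _) _; rewrite -(gapsE _ _ _ w0).
- apply: (allP (gaps_le9 n N)); apply: mem_nth; rewrite size_gaps.
  exact: leq_trans r0 (ngaps_le _ _ _).
- by move=> j j0; rewrite gapsE // -/X; have := Xh 1 j j0; lia.
by move=> j j0; rewrite gapsE.
Qed.

Lemma digits_kaprekar n N (X := ngaps n N) (u := nth 0 (gaps n N) 0)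
    (w := nth 0 (gaps n N) (X 1).-1) : 0 < X 1 ->
  exists p q, [/\ take (X 1) (gaps n N) = rcons p w,
    take (X 1) (gaps n N) = u :: q
    & digits n (kaprekar n N) =
      rcons p w.-1 ++ nseq (n - (X 1).*2) 9 ++ rcons [seq 9 - d | d <- rev q] (10 - u)].
Proof.
move=> r0; set p := take _ _.
have [/andP[w0 wu] _ _ _ _] := gaps_profile r0.
have sp : size p = X 1 by rewrite size_takel // size_mkseq ngaps_le.
have p9 : all (geq 9) p by apply/allP => e /mem_take; apply: (allP (gaps_le9 n N)).
case Eq: p => [|u1 q]; first by move: r0; rewrite -/X -sp Eq.
have Eu : u1 = u by rewrite /u -(nth_take 0 r0) -/p Eq.
case/lastP Ep: p => [|p1 w1]; first by rewrite Ep in Eq.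
have Ew : w1 = w.
  rewrite /w -(@nth_take (X 1)) ?prednK // -/p Ep nth_rcons.
  by move: sp; rewrite Ep size_rcons => <- /=; rewrite ltnn eqxx.
exists p1, q; rewrite -Ew -Eu -Ep -Eq; split=> //.
have -> : kaprekar n N = of_digits p * 10 ^ (n - (X 1).*2 + size p) - of_digits (rev p).
  rewrite kaprekarE gaps_decomp -/X -/p rev_cat rev_nseq of_digits_nseq0 of_digits_zeros.
  by congr (_ * 10 ^ _ - _); move: (ngaps1_double_le n N); rewrite sp -/X; lia.
have {1}-> : n = (n - (X 1).*2) + (size p).*2 by rewrite sp subnK // ngaps1_double_le.
by apply: (digits_borrow _ Ep Eq p9); rewrite ?Eu ?Ew //; apply: leq_trans wu.
Qed.

(** A gap x counts in the left block if x >= [t] and in the right block if x < [s]. Lowering [w]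
    loses one exactly when [t] = [w], and raising 9 - [u] gains one exactly when [s] = [u]. *)
Lemma ndigits_kaprekar n N (X := ngaps n N) t s :
  0 < X 1 -> t + s = 10 -> 0 < t -> 0 < s ->
  ndigits n (kaprekar n N) t + X s + X 1 + (t == nth 0 (gaps n N) (X 1).-1) =
  n + X t + (s == nth 0 (gaps n N) 0).
Proof.
move=> r0 ts t0 s0; have [wu u9 _ _ _] := gaps_profile r0.
have [p [q [Ep Eq E]]] := digits_kaprekar r0.
move: wu u9 Ep Eq; rewrite /ndigits {}E -/X.
set u := nth 0 _ 0; set w := nth 0 _ _ => wu u9 Ep Eq.
have sp : size (rcons p w) = X 1 by rewrite -Ep size_takel // size_mkseq ngaps_le.
have X_ j : 0 < j -> X j = count (leq j) (take (X 1) (gaps n N)).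
  move=> j0; rewrite /X /ngaps {1}gaps_decomp count_cat count_nseq.
  by rewrite leqNgt j0 mul0n addn0.
have q9 : all (geq 9) q.
  have : all (geq 9) (u :: q); last by case/andP.
  by apply/allP => e; rewrite -Eq => /mem_take; apply: (allP (gaps_le9 n N)).
have t9 : 0 < t <= 9 by lia.
have sq : (size q).+1 = X 1 by rewrite -sp -Ep Eq.
have := count_compl t9 q9; have -> : 10 - t = s by lia.
have := ngaps1_double_le n N; rewrite -/X; move: sp; rewrite size_rcons.
move: (X_ t t0) (X_ s s0); rewrite {1}Ep Eq -!cats1.
rewrite !(count_cat, map_rev, count_rev, count_nseq) /=.
by case/andP: t9 => _ ->; lia.
Qed.

(** Each pair x, 9 - x sums to 9, and the two corrections by 1 cancel. *)
Lemma digit_sum_kaprekar n N (X := ngaps n N) : 0 < X 1 ->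
  digit_sum n (kaprekar n N) = 9 * (n - X 1).
Proof.
move=> r0; have [p [q [Ep Eq E]]] := digits_kaprekar r0.
have [/andP[w0 _] u9 _ _ _] := gaps_profile r0.
move: w0 u9 Ep Eq; rewrite /digit_sum {}E -/X.
set u := nth 0 _ 0; set w := nth 0 _ _ => w0 u9 Ep Eq.
have sp : size (u :: q) = X 1 by rewrite -Eq size_takel // size_mkseq ngaps_le.
have q9 : all (geq 9) q.
  have : all (geq 9) (u :: q); last by case/andP.
  by apply/allP => e; rewrite -Eq => /mem_take; apply: (allP (gaps_le9 n N)).
have sumC : sumn [seq 9 - d | d <- q] + sumn q = 9 * size q.
  by elim: q q9 {Eq sp} => //= d q IHq /andP[/= d9 /IHq]; lia.
have : sumn (rcons p w) = sumn (u :: q) by rewrite -Ep Eq.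
rewrite -sumnE !(sumn_cat, sumn_rcons, map_rev, sumn_rev, sumn_nseq) /=.
by move: sp (ngaps1_double_le n N); rewrite -/X /=; lia.
Qed.

Lemma kaprekar_gap_step n N : 0 < ngaps n N 1 ->
  gap_step n (ngaps n N) (ngaps n (kaprekar n N))
    (nth 0 (gaps n N) 0) (nth 0 (gaps n N) (ngaps n N 1).-1).
Proof.
move=> r0; exists (ndigits n (kaprekar n N)); split.
- by move=> t s ts t0 s0; apply: ndigits_kaprekar.
- by move=> t j _ <-; apply: ngaps_lower.
- by move=> t j _ <-; apply: ngaps_upper.
- split=> [t t9|].
    apply/eqP; rewrite -leqn0 leqNgt -has_count; apply/hasPn => d.
    by move/(allP (digits_le9 _ _)) => /=; lia.
  by rewrite /ndigits (eq_count (a2 := predT)) // count_predT size_digits.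
- by move=> t; apply: ndigits_le.
Qed.

(** The counts drop strictly just after [u], where they reach 0, and just after [w], where they
    leave [X 1]. *)
Lemma gap_profile_step (X : nat -> nat) u w j : gap_profile X u w -> 0 < j ->
  X j.+1 + (j == u) <= X j /\ X j.+1 + (j == w) <= X j.
Proof.
case=> _ _ c d e j0; have cj := c _ _ (leqnSn j).
have := d j j0; have := d j.+1 erefl; have := e j j0; have := e j.+1 erefl.
by split; lia.
Qed.

(** * Cycles whose length is twice the number of positive gaps *)

(* The case n = 2 X(1) of gap_step, where the bounds on Y determine it: the gaps of
   D are the |2x - 9| for x a gap of N, up to the corrections due to u and w. *)
Definition balanced (X Y : nat -> nat) (u w : nat) :=
  forall p q j, q + j = p -> p + q = 10 -> 0 < q ->
    (0 < j -> Y j + X q + (w == p) + (u == p) =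
      X 1 + X p + maxn ((u == p) + (u == q)) ((w == p) + (w == q))) /\
    Y j.+1 + X q + (w == p) + (u == p) =
      X 1 + X p + minn ((u == p) + (u == q)) ((w == p) + (w == q)).

Lemma gap_step_balanced n X Y u w :
  n = (X 1).*2 -> gap_profile X u w -> gap_step n X Y u w -> balanced X Y u w.
Proof.
move=> hn sX [G [G1 G2 G3 [G4 G5] G6]] p q j qj pq q0.
(* The strict drops of [X] absorb the corrections in [G1]. With this bound and [S9], both
   alternatives of suitable instances of [G2] and [G3] give the same inequality. *)
have S11 a b : a + b = 11 -> 0 < a <= 10 -> G a + G b <= n.
  move=> ab a0.
  case: (ltngtP a 10) => [a10|a10|a10];
    [| by lia | by subst a; rewrite G4 // G6].
  case: (ltngtP b 10) => [b10|b10|b10];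
    [| by lia | by subst b; rewrite [G 10]G4 // addn0 G6].
  have [a1 b1] : 0 < a.-1 /\ 0 < b.-1 by lia.
  have [+ _] := gap_profile_step sX a1; have [+ _] := gap_profile_step sX b1.
  have := G1 a b.-1 ltac:(lia) ltac:(lia) b1.
  have := G1 b a.-1 ltac:(lia) ltac:(lia) a1.
  by clear - hn a1 b1; rewrite !prednK; lia.
have S9 a b : a + b = 9 -> n <= G a + G b.
  move=> ab.
  case: (posnP a) => [->|a0]; first by rewrite G5 leq_addr.
  case: (posnP b) => [->|b0]; first by rewrite G5 leq_addl.
  have [_ +] := gap_profile_step sX a0; have [_ +] := gap_profile_step sX b0.
  have := G1 a b.+1 ltac:(lia) a0 erefl; have := G1 b a.+1 ltac:(lia) b0 erefl.
  by clear - hn; lia.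
have {S11} [Sa Sb] : G p + G q.+1 <= n /\ G p.+1 + G q <= n by split; apply: S11; lia.
have {S9} [Sc Sd] : n <= G q.-1 + G p /\ n <= G q + G p.-1 by split; apply: S9; lia.
have p0 : 0 < p by lia.
have Gp := G1 p q pq p0 q0; have Gq := G1 q p (etrans (addnC q p) pq) q0 p0.
have hn' : n = X 1 + X 1 by rewrite addnn.
(* [Y j] is the maximum of [G p] and [n - G q], and [Y j.+1] is their minimum. *)
split=> [j0|].
  have q1j : q.-1 + j = p.-1 by clear - qj q0; lia.
  have := G3 _ _ _ qj j0; have := G2 _ _ _ qj j0; have := G2 _ _ _ q1j j0.
  rewrite (prednK q0) => A1 A2 A3.
  have B1 : G p <= Y j by clear - A2 Sa; lia.
  have B2 : n <= Y j + G q by clear - A1 Sd; lia.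
  by clear - A3 B1 B2 Gp Gq hn'; lia.
have qj1 : q + j.+1 = p.+1 by clear - qj; lia.
have q1j : q.-1 + j.+1 = p by clear - qj q0; lia.
have := G3 _ _ _ qj1 erefl; have := G3 _ _ _ q1j erefl; have := G2 _ _ _ q1j erefl.
rewrite (prednK q0) => A1 A2 A3.
have B1 : Y j.+1 <= G p by clear - A2 Sc; lia.
have B2 : Y j.+1 + G q <= n by clear - A3 Sb; lia.
by clear - A1 B1 B2 Gp Gq hn'; lia.
Qed.

(* This cannot be a contradiction: the case w = w' = 2 contains the fixed points
   of the Kaprekar map with gaps 6, 3, ..., 3, 2, such as 631764. *)
Lemma balanced_cycle_eq X Y u w u' w' :
  gap_profile X u w -> gap_profile Y u' w' -> X 1 = Y 1 ->
  balanced X Y u w -> balanced Y X u' w' ->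
  X 9 = 0 -> Y 9 = 0 -> 1 < u -> 1 < u' -> forall j, 0 < j <= 9 -> X j = Y j.
Proof.
move=> sX sY E B B' x9 y9 u1 u'1.
have : w <= w' \/ w' <= w by lia.
wlog ww : X Y u w u' w' sX sY E B B' x9 y9 u1 u'1 / w <= w'.
  move=> W [ww|ww] j j9; first by apply: (W X Y u w u' w') => //; left.
  by apply/esym; apply: (W Y X u' w' u w) => //; left.
move=> _.
have m0 : 0 < X 1 by case: sX => _ _ _ _ e; rewrite e //; lia.
case: sX => a b c d e.
case: sY => a' b' c' d' e'.
have [H1 H2 H3 H4] : [/\ X 2 <= X 1, X 3 <= X 2, X 4 <= X 3 & X 5 <= X 4]
  by split; apply: c.
have [H5 H6 H7 H8] : [/\ X 6 <= X 5, X 7 <= X 6, X 8 <= X 7 & X 9 <= X 8]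
  by split; apply: c.
have [L1 L2 L3 L4] : [/\ Y 2 <= Y 1, Y 3 <= Y 2, Y 4 <= Y 3 & Y 5 <= Y 4]
  by split; apply: c'.
have [L5 L6 L7 L8] : [/\ Y 6 <= Y 5, Y 7 <= Y 6, Y 8 <= Y 7 & Y 9 <= Y 8]
  by split; apply: c'.
(* These instances express [Y 2], ..., [Y 9] through [X], and then conversely. *)
have [/(_ erefl) Pe6 Po6] := B 6 4 2 erefl erefl erefl.
have [/(_ erefl) Pe7 Po7] := B 7 3 4 erefl erefl erefl.
have [/(_ erefl) Pe8 Po8] := B 8 2 6 erefl erefl erefl.
have [/(_ erefl) Pe9 Po9] := B 9 1 8 erefl erefl erefl.
have [/(_ erefl) Qe6 Qo6] := B' 6 4 2 erefl erefl erefl.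
have [/(_ erefl) Qe7 Qo7] := B' 7 3 4 erefl erefl erefl.
have [/(_ erefl) Qe8 Qo8] := B' 8 2 6 erefl erefl erefl.
have [/(_ erefl) Qe9 Qo9] := B' 9 1 8 erefl erefl erefl.
have u8 : u <= 8 by move: (e 9 erefl); clear - x9; lia.
have u8' : u' <= 8 by move: (e' 9 erefl); clear - y9; lia.
have w9 : w <= 8 by clear - u8 a; lia.
have w9' : w' <= 8 by clear - u8' a'; lia.
have x8 : X 8 = (w' == 1) by clear - Qe9 x9 y9 u8' u1 u'1 w9'; lia.
have y8 : Y 8 = (w == 1) by clear - Pe9 x9 y9 u8 u1 u'1 w9; lia.
have uw' : (u == 8) = (w' == 1) by move: (e 8 erefl); clear - u8 x8; lia.
have u'w : (u' == 8) = (w == 1) by move: (e' 8 erefl); clear - u8' y8; lia.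
(* A smallest gap 1 would force a largest gap 8 on the other side, which is refuted first. *)
case: (eqVneq w 1) => w1.
  exfalso.
  case: (eqVneq w' 1) => w1'.
    have [Eu Eu'] : u = 8 /\ u' = 8 by clear - uw' u'w w1 w1'; lia.
    subst; clear - Qo6 Qe6 Po6 Pe6 x8 y8 m0 Po8 Pe8 Qo8 Qe8 Po7 Pe7 Qo7 Qe7
      H1 H2 H3 H4 H5 H6 H7 H8 L1 L2 L3 L4 L5 L6 L7 L8.
    by lia.
  have Eu' : u' = 8 by clear - u'w w1; lia.
  have u7 : u <= 7 by clear - uw' w1' u8; lia.
  have [W8|W8] := eqVneq w' 8.
    have E8 : Y 8 == Y 1 by rewrite d' // W8.
    have E1 : (X u == X 1) = false by rewrite d; clear -w1 u1; lia.
    have E2 := c 1 u (ltnW u1). have E3 : 0 < X u by rewrite e; clear -u1; lia.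
    by clear - E1 E2 E3 E8 E y8 w1; lia.
  have Y2 : Y 2 == Y 1 by rewrite d'; clear - a' w1'; lia.
  have D7 := e 7 erefl. have D6 := e 6 erefl. have D3 := d' 3 erefl.
  have X7 : X 7 = (w' == 2) by clear - Qo8 y8 Eu' w1 W8 Y2 E; lia.
  have X6 : X 6 = 1 by clear - Qe8 y8 Eu' w1 W8 Y2 E; lia.
  have [W2|W2] := eqVneq w' 2.
    have U7 : u = 7 by clear - D7 X7 W2 u7; lia.
    by subst; clear - Po6 Pe6 Y2 D3 E X6 L2; lia.
  have U6 : u = 6 by clear - D7 D6 X7 X6 W2 u7; lia.
  have W3 : 2 < w' by clear - W2 w1' a'; lia.
  by subst; clear - Po6 Pe6 Y2 W3 D3 E X6 L2 H4 H5; lia.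
have w2 : 1 < w by clear - w1 a; lia.
have w2' : 1 < w' by clear - w2 ww; lia.
have u7 : u <= 7 by clear - uw' w2' u8; lia.
have u7' : u' <= 7 by clear - u'w w2 u8'; lia.
have X2 : X 2 == X 1 by rewrite d.
have Y2 : Y 2 == Y 1 by rewrite d'.
(* With all gaps between 2 and 7, a gap above 5 arises only from a correction at a gap 2 of the
   other side. *)
have X7 : X 7 = (u' == 2) by clear - Qo8 y8 Y2 E u7' a' w2' w2; lia.
have Y7 : Y 7 = (u == 2) by clear - Po8 x8 X2 E u7 a w2' w2; lia.
have X6 : X 6 = (w' == 2) by clear - Qe8 y8 Y2 E u7' a' w2' w2; lia.
have Y6 : Y 6 = (w == 2) by clear - Pe8 x8 X2 E u7 a w2' w2; lia.
have U7 : (u == 7) = (u' == 2) by move: (e 7 erefl); clear - X7 u7; lia.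
have U7' : (u' == 7) = (u == 2) by move: (e' 7 erefl); clear - Y7 u7'; lia.
have D6 := e 6 erefl. have D6' := e' 6 erefl.
have u2' : u' != 2 by clear - D6' D6 Y6 X6 U7 U7' a a' w2 w2' ww u7 u7'; lia.
have u2 : u != 2.
  have D3 := e 3 erefl; have D4 := e 4 erefl; have D5 := e 5 erefl.
  apply/negP => /eqP u2.
  have Eu' : u' = 7 by clear - U7' u2; lia.
  have Ew : w = 2 by clear - a u2 w2; lia.
  have D7' := d' 7 erefl.
  by subst; clear - Qo6 Qe6 Y6 Y7 D3 D7' X2 E L1 L2 L3; lia.
have D5 := e 5 erefl. have D5' := e' 5 erefl.
have D4 := e 4 erefl. have D4' := e' 4 erefl.
have u6 : u <= 6 by clear - U7 u2' u7; lia.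
have u6' : u' <= 6 by clear - U7' u2 u7'; lia.
have {X7} X7 : X 7 = 0 by clear - X7 u2'; lia.
have {Y7} Y7 : Y 7 = 0 by clear - Y7 u2; lia.
have D3 := d 3 erefl. have D3' := d' 3 erefl.
have G4 := d 4 erefl. have G4' := d' 4 erefl. have F3 := e 3 erefl.
have {X2} X2 : X 2 = X 1 by apply/eqP. have {Y2} Y2 : Y 2 = X 1 by rewrite E; apply/eqP.
have {D6} D6 : (u == 6) = (w' == 2) by clear - D6 X6 u6; lia.
have {D6'} D6' : (u' == 6) = (w == 2) by clear - D6' Y6 u6'; lia.
have [W2|W2] := eqVneq w 2.
  have [W2'|W2'] := eqVneq w' 2.
    (* The only surviving case; all others end in a contradiction. *)
    have [Eu Eu'] : u = 6 /\ u' = 6 by clear - W2 W2' D6 D6'; lia.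
    subst u u' w w'.
    have S : [/\ X 3 = Y 3, X 4 = Y 4 & X 5 = Y 5].
      clear - Po7 Pe7 Po6 Pe6 Qo7 Qe7 Qo6 Qe6 X6 Y6 X7 Y7 E X2 Y2.
      by split; lia.
    case: S => S3 S4 S5 [|[|[|[|[|[|[|[|[|[|j]]]]]]]]]] //; congruence.
  have Eu' : u' = 6 by clear - W2 D6'; lia.
  exfalso; have w3' : 2 < w' by clear - W2' w2'; lia.
  have {D3'} D3' : Y 3 = X 1 by move: (d' 3 erefl); clear - w3' E; lia.
  have X60 : X 6 = 0 by clear - X6 W2'; lia.
  have u5 : u <= 5 by clear - D6 W2' u6; lia.
  have X4 : X 4 = 0 by clear - Po6 D3' X60 W2 u5; lia.
  have u3 : u = 3 by clear - X4 D4 u1 u2; lia.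
  have Y61 : Y 6 = 1 by clear - Y6 W2; lia.
  have W3 : w' != 3 by clear - Qe7 X4 D3' Y7 E Eu' a'; lia.
  have Y4 : Y 4 = X 1 by clear - G4' W3 w3' E; lia.
  have X3 : X 3 = 1 by clear - Pe7 Y4 X4 u3 W2 X7; lia.
  have W4 : w' = 4 by clear - Qo6 X3 Y4 Y61 Eu' E a'; lia.
  have X21 : X 2 = 1 by clear - Qe6 Y4 Y61 Eu' W4 E; lia.
  by clear - X21 X2 X3 D3 W2; lia.
exfalso.
have w3 : 2 < w by clear - w2 W2; lia.
have w3' : 2 < w' by clear - w3 ww; lia.
have {X6} X6 : X 6 = 0 by clear - X6 w3'; lia.
have {Y6} Y6 : Y 6 = 0 by clear - Y6 w3; lia.
have {D6} u5 : u <= 5 by clear - D6 w3' u6; lia.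
have {D6'} u5' : u' <= 5 by clear - D6' w3 u6'; lia.
have {D3} D3 : X 3 = X 1 by move: (d 3 erefl); clear - w3; lia.
have {D3'} D3' : Y 3 = X 1 by move: (d' 3 erefl); clear - w3' E; lia.
(* With all gaps between 3 and 5, at most one gap on each side exceeds 3. *)
have Y5 : Y 5 = (u == 3) by clear - Po7 D3 X7 a w3 u5; lia.
have Y4 : Y 4 = (w == 3) by clear - Pe7 D3 X7 a w3 u5; lia.
have X5 : X 5 = (u' == 3) by clear - Qo7 D3' Y7 a' w3' u5' E; lia.
have X4 : X 4 = (w' == 3) by clear - Qe7 D3' Y7 a' w3' u5' E; lia.
have W3 : w = 3 by clear - Y4 G4' ww w3 E m0; lia.
have [W3'|W3'] := eqVneq w' 3.
  have [Eu Eu'] : u = 4 /\ u' = 4.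
    by clear - X4 Y4 X5 Y5 D4 D4' D5 D5' W3 W3' u5 u5'; split; lia.
  by clear - Po6 D3' X4 X6 Eu W3 W3'; lia.
have u3 : u = 3 by clear - X4 W3' D4 a w3; lia.
by clear - Qo6 D3 Y4 Y6 W3 D5' Y5 u3 u5' E; lia.
Qed.

(* When n = 2 X(1), the equation on X 9 says that kaprekar n N has no digit 9. *)
Lemma balanced_cycle_eq_no_nine X Y u w u' w' :
  gap_profile X u w -> gap_profile Y u' w' -> X 1 = Y 1 ->
  balanced X Y u w -> balanced Y X u' w' ->
  X 9 + (u == 1) = (w == 9) -> forall j, 0 < j <= 9 -> X j = Y j.
Proof.
move=> sX sY E B B' N.
have sX' := sX; case: sX => a b c d e.
have sY' := sY; case: sY => a' b' c' d' e'.
have [/(_ erefl) Pe9 Po9] := B 9 1 8 erefl erefl erefl.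
have [/(_ erefl) Qe9 Qo9] := B' 9 1 8 erefl erefl erefl.
have D9 := e 9 erefl.
have E9 := d 9 erefl.
have D9' := e' 9 erefl. have D1 := e 1 erefl.
(* A smallest gap 9 leads to the chain 90, 81, 63, whose gaps 9, 7, 3 do not return to 9. *)
have [W|W] := eqVneq w 9.
  exfalso.
  have [/(_ erefl) Pe8 Po8] := B 8 2 6 erefl erefl erefl.
  have [/(_ erefl) _ Po6] := B' 7 3 4 erefl erefl erefl.
  have U : u = 9 by clear - W a b; lia.
  have X1 : X 1 = 1 by clear - N W U E9; lia.
  have Xj j : 0 < j <= 9 -> X j = 1.
    rewrite -{1}W => /andP[j0 jw].
    by have : X j == X 1; [rewrite d | rewrite X1 => /eqP].
  have {Pe9 Po8} [Y8 Y7] : Y 8 = 0 /\ Y 7 = 1.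
    by move: Pe9 Po8; rewrite U W !Xj //; clear; split; lia.
  have u7 : u' = 7 by move: (e' 7 erefl) (e' 8 erefl); clear - Y7 Y8; lia.
  have w7 : w' = 7 by move: (d' 7 erefl); clear - Y7 X1 E a' u7; lia.
  have Y3 : Y 3 = 1 by have : Y 3 == Y 1; [rewrite d' // w7 | rewrite -E X1 => /eqP].
  by move: Po6; rewrite Xj // Y3 u7 w7 Y7 -E X1; clear; lia.
have X9 : X 9 = 0 by clear - N W; lia.
have u1 : u != 1 by clear - N W X9; lia.
have Y9 : Y 9 = 0 by clear - Po9 X9 u1 W D1 D9 a; lia.
apply: (balanced_cycle_eq sX' sY' E B B' X9 Y9).
  by clear - u1 a; lia.
have w9' : w' != 9 by clear - a' D9' Y9; lia.
clear - Qo9 X9 Y9 a' w9' D9'; lia.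
Qed.

(** * Different numbers of positive gaps *)

(** For [t] = [s] = 5 the terms [Y 5] cancel, so [G 5] is [n - Y 1] up to 1. Each alternative of
    [G2] then needs a correction at a gap 5. *)
Lemma unequal_ranks_cases n (X Y : nat -> nat) u' w' :
  X 1 < Y 1 -> (Y 1).*2 <= n -> gap_profile Y u' w' -> gap_step n Y X u' w' ->
  Y 1 = (X 1).+1 /\ ((n = (Y 1).*2 /\ w' = 5 /\ 5 < u') \/ (w' < 5 /\ u' = 5)).
Proof.
move=> lt h [a _ _ _ _] [G [G1 G2 _ _ _]].
have := G1 5 5 erefl erefl erefl; have := G2 4 1 5 erefl erefl.
by clear - lt h a; lia.
Qed.

(** It turns out that [X 9] is [X 1 - 1] and positive; the two upper bounds at gap 9 then give both
    [Y 9 < X 9] and [X 9 <= Y 9]. *)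
Lemma unequal_ranks_absurd n (X Y : nat -> nat) u w u' w' :
  0 < X 1 -> Y 1 = (X 1).+1 -> n = (Y 1).*2 ->
  gap_profile X u w -> gap_profile Y u' w' ->
  gap_step n Y X u' w' -> gap_step n X Y u w -> w' = 5 -> False.
Proof.
move=> r0 rs hn [a b c d e] [_ _ _ d' _].
move=> [G [G1 _ G3 [G4 _] _]] [H [H1 _ H3 [H4 _] _]] w'5.
have h10 := H4 10 erefl; have g10 := G4 10 erefl.
have Y5 : Y 5 = Y 1 by apply/eqP; rewrite d' // w'5.
have h5 := H1 5 5 erefl erefl erefl.
have w5 : w = 5 /\ u != 5.
  have := H3 5 5 10 erefl erefl; rewrite h10 Y5 => U.
  by clear - U h5 hn rs r0; lia.
case: w5 => w5 u5; have u6 : 5 < u by clear - a w5 u5; lia.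
have X4 : X 4 = X 1 by apply/eqP; rewrite d // w5.
have X6 : X 6 < X 1 by have := d 6 erefl; have := c 1 6 erefl; clear - w5; lia.
have X6' : 0 < X 6 by rewrite e.
have X9 : (X 9).+1 = X 1.
  have h4 := H1 4 6 erefl erefl erefl; have h9 := H1 9 1 erefl erefl erefl.
  have := H3 4 5 9 erefl erefl; rewrite Y5 => U.
  have X96 : X 9 <= X 6 by apply: c.
  by clear - U h4 h9 X4 X6 X96 hn rs w5 u6; lia.
have u9 : u = 9 by have := e 9 erefl; clear - X9 X6 X6' b; lia.
have g1 := G1 1 9 erefl erefl erefl; have h1 := H1 1 9 erefl erefl erefl.
have := G3 1 9 10 erefl erefl; have := H3 1 9 10 erefl erefl; rewrite h10 g10.
by clear - g1 h1 u9 w5 w'5 X9 X6 X6'; lia.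
Qed.

(** The image counted by [H] has nines but no gap above 5, so all its digits are at least 4. This
    confines the gaps counted by [X] to 5 and 6. *)
Lemma unequal_ranks_exception n (X Y : nat -> nat) u w u' w' :
  0 < X 1 -> Y 1 = (X 1).+1 -> (Y 1).*2 <= n ->
  gap_profile X u w -> gap_profile Y u' w' ->
  gap_step n Y X u' w' -> gap_step n X Y u w -> w' < 5 -> u' = 5 ->
  [/\ n = 5, X 1 = 1, u = 6, w = 6 & w' = 4].
Proof.
move=> r0 rs hn [a _ c d e] [_ _ c' d' e'].
move=> [G [G1 G2 G3 _ _]] [H [H1 H2 H3 _ _]] w'5 u'5.
have Y0 j : 5 < j -> Y j = 0 by move=> j5; have := e' j; clear - j5 u'5; lia.
have [Y5 Y51] : 0 < Y 5 /\ Y 5 <= X 1.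
  have := e' 5 erefl; have := d' 5 erefl; have := c' 1 5 erefl.
  by clear - w'5 u'5 rs; lia.
have h9 := H1 9 1 erefl erefl erefl; have h4 := H1 4 6 erefl erefl erefl.
have h5 := H1 5 5 erefl erefl erefl; have h6 := H1 6 4 erefl erefl erefl.
have X9w : (9 == w) <= X 9.
  by have := d 9 erefl; clear - r0; lia.
have H9 : n <= H 9 + (X 1).*2 by clear - X9w h9; lia.
have H4n : n <= H 4.
  by have := H2 3 6 9 erefl erefl; rewrite Y0 //; clear - H9 hn rs r0; lia.
have X4 : X 4 <= X 1 by apply: c.
have [w4 [X6 u6]] : 4 < w /\ X 6 = (u == 6) /\ u <= 6.
  have := e 6 erefl; have := d 4 erefl; clear - H4n h4 X4 r0; lia.
have {X4} X4 : X 4 = X 1 by apply/eqP; rewrite d // ltnW.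
have X5 : X 5 = X 1 by apply/eqP; rewrite d.
have Y4 := c' 1 4 erefl.
have W' : Y 4 = Y 1 -> w' = 4 by have := d' 4 erefl; clear - w'5; lia.
have g9 := G1 9 1 erefl erefl erefl; have g4 := G1 4 6 erefl erefl erefl.
rewrite (Y0 9) // in g9; rewrite (Y0 6) // in g4.
(* Of the pairs ([w], [u]) = (5, 5), (5, 6), (6, 6) only the last survives. *)
have [E|u5] := eqVneq u 6; last first.
  have [{}u5 w5] : u = 5 /\ w = 5 by clear - u5 u6 w4 a; lia.
  exfalso.
  have Y1 := H3 5 1 6 erefl erefl.
  have w'4 : w' = 4.
    apply: W'; have := H2 5 4 9 erefl erefl.
    by clear - Y1 H9 h5 h6 X6 X4 u5 w5 rs r0 Y4; lia.
  have {}Y4 : Y 4 = Y 1 by apply/eqP; rewrite d' // w'4.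
  have g6 := G1 6 4 erefl erefl erefl. have g1 := G1 1 9 erefl erefl erefl.
  rewrite (Y0 6) // in g6; rewrite (Y0 9) // in g1.
  have := G2 3 6 9 erefl erefl; have := G3 1 5 6 erefl erefl.
  clear - g1 g4 g6 g9 Y4 X5 X6 w'4 u'5 u5 w5 Y1 h6 h5 X4 rs r0 hn; lia.
have [w5|w6] := eqVneq w 5.
  exfalso.
  have X61 : X 6 < X 1 by have := d 6 erefl; have := c 1 6 erefl; clear - w5; lia.
  have H9Y : H 9 <= Y 5.
    have := H2 4 5 9 erefl erefl; clear - h5 E w5 rs Y51; lia.
  have Y4' : 1 < Y 4.
    have := H2 5 4 9 erefl erefl; clear - H9 h6 X4 X6 X61 E w5 rs hn; lia.
  have := G3 4 5 9 erefl erefl; have := d' 4 erefl.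
  clear - g4 g9 X5 H9Y H9 Y4' Y51 E X6 X61 rs hn u'5; lia.
have {w4 w6} w6 : w = 6 by clear - w4 w6 a E; lia.
have X1 : X 1 = 1 by have := d 6 erefl; clear - X6 E w6; lia.
have w'4 : w' = 4.
  apply: W'; have := H2 5 4 9 erefl erefl.
  by clear - H9 h6 X1 X6 X4 E w6 rs Y4 hn; lia.
have Y3 : Y 3 = Y 1 by apply/eqP; rewrite d' // w'4.
have g3 := G1 3 7 erefl erefl erefl.
rewrite (Y0 7) // in g3.
(* [g9] counts [n - 4] nines; [U] gives at least one and [V] at most one. *)
have U := G3 3 6 9 erefl erefl; have V := G2 8 1 9 erefl erefl.
by split=> //; clear - U V g3 g9 X1 X6 E w6 w'4 u'5 rs hn Y3; lia.
Qed.

(** * Return from gap counts to the numbers of a cycle *)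

Lemma gaps_inj n C D : (forall j, 0 < j <= 9 -> ngaps n C j = ngaps n D j) ->
  gaps n C = gaps n D.
Proof.
move=> CD; have le N M : (forall j, 0 < j <= 9 -> ngaps n N j = ngaps n M j) ->
    forall i, i < n -> nth 0 (gaps n N) i <= nth 0 (gaps n M) i.
  move=> NM i lti; case: (posnP (nth 0 (gaps n N) i)) => [-> //|x0].
  rewrite gapsE // -NM -?gapsE // x0.
  by apply: (allP (gaps_le9 n N)); rewrite mem_nth // size_mkseq.
apply: (@eq_from_nth _ 0) => [|i]; rewrite !size_mkseq // => lti.
by apply/anti_leq; rewrite !le // => j j9; rewrite CD.
Qed.

Lemma kaprekar_of_gaps n C D : gaps n C = gaps n D -> kaprekar n C = kaprekar n D.
Proof. by move=> E; rewrite !kaprekarE E. Qed.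

Lemma kaprekar_eq0 n N : ngaps n N 1 = 0 -> kaprekar n N = 0.
Proof.
move=> r0; rewrite kaprekarE gaps_decomp r0 take0 cat0s rev_nseq.
by rewrite subnn.
Qed.

Lemma kaprekar_0 n : kaprekar n 0 = 0.
Proof.
rewrite /kaprekar /descending.
have /all_pred1P -> : all (pred1 0) (sort geq (digits n 0)).
  by rewrite all_sort; apply/allP => _ /mapP[i _ ->]; rewrite /= div0n mod0n.
by rewrite -[nseq _ _]cats0 of_digits_nseq0 sub0n.
Qed.

Lemma kaprekar_2cycle_sym n C D : kaprekar_2cycle n C D -> kaprekar_2cycle n D C.
Proof. by case=> ? ? CD ? ?; split=> // /esym. Qed.

Lemma ngaps_gt0 n C D : kaprekar_2cycle n C D -> 0 < ngaps n C 1.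
Proof.
case=> _ _ CD EC ED; rewrite lt0n; apply/eqP => /kaprekar_eq0; rewrite EC => D0.
by case: CD; rewrite -ED D0 kaprekar_0.
Qed.

Lemma unequal_ngaps n C D : kaprekar_2cycle n C D -> ngaps n C 1 < ngaps n D 1 ->
  [/\ n = 5, C = 53955 & D = 59994].
Proof.
move=> h lt; have r0 := ngaps_gt0 h; have s0 := ngaps_gt0 (kaprekar_2cycle_sym h).
have [_ _ _ EC ED] := h.
have pC := gaps_profile r0; have pD := gaps_profile s0.
have sC := kaprekar_gap_step r0; have sD := kaprekar_gap_step s0.
rewrite EC in sC; rewrite ED in sD.
have [rs [[hn [w5 u5]]|[w5 u5]]] := unequal_ranks_cases lt (ngaps1_double_le n D) pD sD.
  by case: (unequal_ranks_absurd r0 rs hn pC pD sD sC w5).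
have [n5 X1 u6 w6 w4] :=
  unequal_ranks_exception r0 rs (ngaps1_double_le n D) pC pD sD sC w5 u5.
have gC : gaps n C = [:: 6; 0; 0; 0; 0].
  rewrite gaps_decomp X1 n5; move: u6 (size_gaps n C).
  rewrite n5; case: (gaps 5 C) => [|x s] //= -> _; by rewrite take0.
have gD : gaps n D = [:: 5; 4; 0; 0; 0].
  rewrite rs X1 in w4.
  rewrite gaps_decomp rs X1 n5; move: u5 w4 (size_gaps n D).
  rewrite n5; case: (gaps 5 D) => [|x [|y s]] //= -> -> _; by rewrite take0.
(* The gaps determine the images: 54000 - 45 and 60000 - 6. *)
split=> //; [rewrite -ED kaprekarE gD | rewrite -EC kaprekarE gC];
  by apply/eqP; vm_compute.
Qed.

Lemma mem9_kaprekar n C D : kaprekar_2cycle n C D -> 9 \in digits n D.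
Proof.
move=> h; have r0 := ngaps_gt0 h; have s0 := ngaps_gt0 (kaprekar_2cycle_sym h).
have [_ _ CD EC ED] := h.
have pC := gaps_profile r0; have pD := gaps_profile s0.
have sC := kaprekar_gap_step r0; have sD := kaprekar_gap_step s0.
have h9 := ndigits_kaprekar r0 (erefl : 9 + 1 = 10) erefl erefl.
rewrite EC in sC h9; rewrite ED in sD.
suff : 0 < ndigits n D 9.
  rewrite -has_count => /hasP[d dD d9]; suff -> : 9 = d by [].
  by apply/anti_leq; rewrite d9; have := allP (digits_le9 n D) d dD.
(* [D] has at least [n - (ngaps n C 1).*2] nines, so having none makes this difference 0. *)
rewrite lt0n; apply/negP => /eqP G9; rewrite {}G9 in h9.
have hn := ngaps1_double_le n C.
have w9 : (9 == nth 0 (gaps n C) (ngaps n C 1).-1) <= ngaps n C 9.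
  by have [_ _ _ d _] := pC; have := d 9 erefl; clear - r0; lia.
have hC : n = (ngaps n C 1).*2 by clear - h9 hn w9; lia.
have E : ngaps n C 1 = ngaps n D 1.
  (* The exceptional pair has five digits, whereas [n] is even here. *)
  case: (ltngtP (ngaps n C 1) (ngaps n D 1)) => // [lt|gt].
    by have [n5 _ _] := unequal_ngaps h lt; clear - n5 hC; lia.
  by have [n5 _ _] := unequal_ngaps (kaprekar_2cycle_sym h) gt; clear - n5 hC; lia.
have hD : n = (ngaps n D 1).*2 by rewrite -E.
have bC := gap_step_balanced hC pC sC; have bD := gap_step_balanced hD pD sD.
case: CD; suff : kaprekar n C = kaprekar n D by rewrite EC ED => ->.
apply/kaprekar_of_gaps/gaps_inj; apply: (balanced_cycle_eq_no_nine pC pD E bC bD).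
by clear - h9 hC; lia.
Qed.

Theorem theorem1p4 (n C D : nat) (hCD : kaprekar_2cycle n C D) :
  ([fset C; D]%fset <> [fset 53955; 59994]%fset ->
     digit_sum n C = digit_sum n D) /\
  (9 \in digits n C /\ 9 \in digits n D).
Proof.
have hDC := kaprekar_2cycle_sym hCD.
split; last by split; [exact: mem9_kaprekar hDC | exact: mem9_kaprekar hCD].
move=> ne; have [_ _ _ EC ED] := hCD.
have E : ngaps n C 1 = ngaps n D 1.
  case: (ltngtP (ngaps n C 1) (ngaps n D 1)) => // [lt|gt]; case: ne.
    by have [_ -> ->] := unequal_ngaps hCD lt.
  by have [_ -> ->] := unequal_ngaps hDC gt; rewrite fsetUC.
have sD := digit_sum_kaprekar (ngaps_gt0 hCD).
have sC := digit_sum_kaprekar (ngaps_gt0 hDC).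
by rewrite EC in sD; rewrite ED in sC; rewrite sC sD E.
Qed.
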